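(* Let $W_1,W_2,\dots$ be i.i.d. $\mathcal{W}$-valued with law $\lambda_0$ and let $\mathcal{N}_n=\widehat{\mathcal{N}}_n(W_1,\dots,W_n)$. Then the sequence of random sets $\{\mathcal{N}_n\}$ converges almost surely to $\mathcal{M}(\lambda_0)$ in $\mathfrak{C}$ equipped with the upper Vietoris topology.
   Context: Standing assumptions: $\mathcal{X}$ compact metric space, $\mathcal{W}$ complete separable metric space; $\mathcal{P}(S)$ = Borel probability measures on $S$ with the weak topology. $\mathcal{C}$ maps $w$ to a nonempty closed $\mathcal{C}(w)\subset\mathcal{X}$, continuous in the sense that $\mathrm{Gr}(\mathcal{C})=\{(w,x):x\in\mathcal{C}(w)\}$ is closed and whenever $w_n\to w$, $x\in\mathcal{C}(w)$ there exist $n_k$, $x_{n_k}\in\mathcal{C}(w_{n_k})$ with $x_{n_k}\to x$. $F:\mathcal{P}(\mathcal{W}\times\mathcal{X})\times\mathcal{W}\times\mathcal{X}\to\mathbb{R}$ bounded continuous. A Nash equilibrium with type vector $(w_1,\dots,w_n)$ is $(x_1,\dots,x_n)$ with $x_i\in\mathcal{C}(w_i)$ and $F(\frac1n\sum_k\delta_{(w_k,x_k)},w_i,x_i)=\inf_{y\in\mathcal{C}(w_i)}F(\frac1n\sum_{k\ne i}\delta_{(w_k,x_k)}+\frac1n\delta_{(w_i,y)},w_i,y)$ for all $i$; such equilibria are assumed to exist for all $n$ and type vectors. $\widehat{\mathcal{N}}_n(w_1,\dots,w_n)$ is the set of $\frac1n\sum_i\delta_{(w_i,x_i)}$ over all Nash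 equilibria $(x_1,\dots,x_n)$ with type vector $(w_1,\dots,w_n)$ (a closed subset of $\mathcal{P}(\mathcal{W}\times\mathcal{X})$). $\mathcal{M}(\lambda)$ is the (closed) set of $m\in\mathcal{P}(\mathcal{W}\times\mathcal{X})$ with first marginal $\lambda$ such that for $m$-a.e. $(w,x)$, $x\in\mathcal{C}(w)$ and $F(m,w,x)=\inf_{y\in\mathcal{C}(w)}F(m,w,y)$. $\mathfrak{C}$ is the set of closed subsets of $\mathcal{P}(\mathcal{W}\times\mathcal{X})$; the upper Vietoris topology on $\mathfrak{C}$ is generated by the base of sets $\{A\in\mathfrak{C}:A\subset E\}$, $E\subset\mathcal{P}(\mathcal{W}\times\mathcal{X})$ open. *)

(* Defs.v *)
From HB Require Import structures.
From mathcomp Require Import all_boot all_order all_algebra.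
From mathcomp Require Import all_classical all_reals all_analysis.
Import Order.TTheory GRing.Theory Num.Theory.
Import numFieldNormedType.Exports.

Set Implicit Arguments.
Unset Strict Implicit.
Unset Printing Implicit Defensive.

Local Open Scope classical_set_scope.
Local Open Scope ring_scope.

(* Pointed metric spaces (the library's metricType together with a point;
   the spaces W and X of the paper are nonempty). *)
#[short(type="pmetricType")]
HB.structure Definition PointedMetric (K : numDomainType) :=
  {M of isPointed M & Metric K M}.

Notation borel_of T := (g_sigma_algebraType (@open T)).

Section empirical.
Context d (T : measurableType d) (R : realType) (n : nat) (z : 'I_n.+1 -> T).

Definition emp_meas :=
  @mscale _ T R ((n.+1%:R : R)^-1)%:nng (msum (fun k : nat => \d_(z (inord k))) n.+1).

HB.instance Definition _ := Measure.on emp_meas.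

Lemma emp_meas_setT : emp_meas setT = 1%E.
Proof.
change (((n.+1%:R : R)^-1)%:E * \sum_(k < n.+1) \d_(z (inord k)) [set: T] = 1)%E.
rewrite (eq_bigr (fun=> 1%E)); last by move=> i _; exact: diracT.
rewrite sumEFin big_const_ord iter_addr addr0 -EFinM.
by rewrite mulVf // pnatr_eq0.
Qed.

HB.instance Definition _ :=
  Measure_isProbability.Build _ _ _ emp_meas emp_meas_setT.

Definition emp : probability T R := emp_meas.

End empirical.
Arguments emp {d T R n} z.


Section game.
Context {R : realType} {W X : pmetricType R}.

Local Notation BW := (borel_of W).
Local Notation WX := (borel_of (W * X)%type).
Local Notation PWX := (probability WX R).

Definition rint (m : PWX) (f : (W * X)%type -> R) : R :=
  fine (\int[m]_z (f z)%:E)%E.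

Definition bounded_continuous (f : (W * X)%type -> R) :=
  continuous f /\ exists M : R, forall z, `|f z| <= M.

Definition weak_open (E : set PWX) :=
  forall m, E m -> exists (k : nat) (f : 'I_k -> (W * X)%type -> R) (eps : R),
    0 < eps /\ (forall i, bounded_continuous (f i)) /\
    (forall m', (forall i, `|rint m' (f i) - rint m (f i)| < eps) -> E m').

Definition F_continuous (F : PWX -> W -> X -> R) :=
  forall m w x (eps : R), 0 < eps ->
    exists (E : set PWX) (delta : R), weak_open E /\ E m /\ 0 < delta /\
      forall m' w' x', E m' -> ball w delta w' -> ball x delta x' ->
        `|F m' w' x' - F m w x| < eps.

Definition profile n (w : 'I_n.+1 -> W) (x : 'I_n.+1 -> X) : 'I_n.+1 -> WX :=
  fun k => (w k, x k).

Definition deviate n (x : 'I_n.+1 -> X) (i : 'I_n.+1) (y : X) : 'I_n.+1 -> X :=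
  fun k => if k == i then y else x k.

Definition is_nash (F : PWX -> W -> X -> R) (C : W -> set X)
    n (w : 'I_n.+1 -> W) (x : 'I_n.+1 -> X) :=
  (forall i, C (w i) (x i)) /\
  forall i, F (emp (profile w x)) (w i) (x i) =
    inf [set F (emp (profile w (deviate x i y))) (w i) y | y in C (w i)].

Definition Nhat (F : PWX -> W -> X -> R) (C : W -> set X)
    n (w : 'I_n.+1 -> W) : set PWX :=
  [set m | exists x, is_nash F C w x /\
     (m : set WX -> \bar R) = emp (profile w x)].

Definition Mset (F : PWX -> W -> X -> R) (C : W -> set X)
    (lam : probability BW R) : set PWX :=
  [set m : PWX | (forall A : set BW, measurable A ->
       m ((A `*` [set: X]) : set WX) = lam A) /\
     {ae m, forall z : WX, C z.1 z.2 /\ F m z.1 z.2 = inf [set F m z.1 y | y in C z.1]}].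

End game.

Definition iid {R : realType} {dO} {Omega : measurableType dO}
    {dT} {T : measurableType dT}
    (P : probability Omega R) (Wr : nat -> Omega -> T) (lam : probability T R) :=
  forall (n : nat) (A : nat -> set T), (forall i, measurable (A i)) ->
    P (\bigcap_(i in `I_n) (Wr i @^-1` A i)) = (\prod_(i < n) lam (A i))%E.

(* Main.v *)
(** Suppose that, for a fixed sequence of types, Nash equilibria with empirical
    measures [m_n] outside [E] exist for infinitely many [n], and let [U] be an
    ultrafilter on [nat] concentrated on these [n]. The set function
    [p A = lim_U m_n A] is only finitely additive, but the infimum of
    [\sum_i p (O_i)] over countable open covers is an outer measure for which
    open sets are Caratheodory measurable, and it satisfies [m O <= p O] for [O]
    open, so that [m_n] converges weakly to [m] along [U]. No mass is lost: by
    compactness of [X], open sets [O_i] increasing to [W * X] contain cylinders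
    over open sets [G_i] increasing to [W], and [p (G_i * X) >= lam0 G_i -> 1].
    The same bound identifies the first marginal of [m] as [lam0]. If
    [y0 \in C w0] is strictly better than [x0] under [m], then by continuity of
    [F] and lower semicontinuity of [C] no player of the [n]-th equilibrium has
    (type, strategy) in some neighbourhood of [(w0, x0)], for [U]-most [n], so
    this neighbourhood is [m]-null; countably many of them cover all such
    points. Hence [m] lies in [M(lam0)], hence in [E], and so does [m_n] for
    [U]-most [n], a contradiction.

    The only probabilistic input is that almost surely
    [liminf_n lam_n O >= lam0 O] for all open [O], where [lam_n] is the empirical
    measure of the types: this is the strong law of large numbers (Chebyshev
    along squares, then monotonicity) for finite unions of basic open sets. *)
Require Import Defs.
From HB Require Import structures.
From mathcomp Require Import all_boot all_order all_algebra.
From mathcomp Require Import all_classical all_reals all_analysis.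
From mathcomp Require Import measurable_realfun.
From mathcomp Require Import zify ring lra.
Import Order.TTheory GRing.Theory Num.Theory.
Import numFieldNormedType.Exports.
Local Open Scope classical_set_scope.
Local Open Scope ring_scope.

Set Implicit Arguments.
Unset Strict Implicit.
Unset Printing Implicit Defensive.

HB.instance Definition _ (R : numDomainType) (W X : pseudoPMetricType R) :=
  Pointed.on (W * X)%type.

(** * Limits of masses along an ultrafilter *)

(** The limit is the supremum of [S], the set of [r] lying below [u] on a set of [U]. If [u] did not
    stay below [sup S + e] on a set of [U], then, [U] being an ultrafilter, [sup S + e] would itself
    belong to [S]. *)
Lemma ultra_bounded_cvg {R : realType} {I : Type} (U : set_system I)
    (UU : UltraFilter U) (u : I -> R) (M : R) :
  (forall i, `|u i| <= M) -> cvg (u @ U).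
Proof.
move=> uM; pose S := [set r | \forall i \near U, r <= u i].
have SN : S (- M) by apply: nearW => i; have := uM i; rewrite ler_norml => /andP[].
have Sub : ubound S M.
  move=> r Sr; have [i] := @filter_ex _ _ _ _ Sr.
  by move/le_trans; apply; apply: le_trans (uM i); exact: ler_norm.
have hS : has_sup S by split; [exists (- M)|exists M].
apply/cvg_ex; exists (sup S); apply/cvgrPdist_le => e e0.
have lo : \forall i \near U, sup S - e <= u i.
  have [r Sr er] := sup_adherent e0 hS.
  by apply: filterS Sr => i; apply: le_trans; exact: ltW.
have up : \forall i \near U, u i <= sup S + e.
  case: (in_ultra_setVsetC [set i | sup S + e <= u i] UU) => [h|].
    have : sup S + e <= sup S by apply: ub_le_sup => //; exists M.
    by rewrite gerDl leNgt e0.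
  by apply: filterS => i /= /negP; rewrite -ltNge => /ltW.
near=> i; rewrite distrC ler_distl; apply/andP; split; near: i => //.
Unshelve. all: by end_near. Qed.

Section ultralimit_mass.
Context {d} {T : measurableType d} {R : realType}.
Variables (U : set_system nat) (UU : UltraFilter U).
Variable mn : nat -> probability T R.

Definition ultra_mass (A : set T) : R := lim ((fun n => fine (mn n A)) @ U).

Lemma fine_probability_itv (P : probability T R) (A : set T) :
  measurable A -> 0 <= fine (P A) <= 1.
Proof.
move=> mA; rewrite fine_ge0//= -lee_fin fineK ?fin_num_measure//.
exact: probability_le1.
Qed.

Lemma ultra_mass_cvg A : measurable A ->
  (fun n => fine (mn n A)) @ U --> ultra_mass A.
Proof.
move=> mA; apply: (@ultra_bounded_cvg _ _ _ _ _ 1) => n.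
by have /andP[a b] := fine_probability_itv (mn n) mA; rewrite ger0_norm.
Qed.

Lemma ultra_mass_ge A r : measurable A ->
  (\forall n \near U, r <= fine (mn n A)) -> r <= ultra_mass A.
Proof. by move=> mA; apply: limr_ge; exact: ultra_mass_cvg. Qed.

Lemma ultra_mass_le A r : measurable A ->
  (\forall n \near U, fine (mn n A) <= r) -> ultra_mass A <= r.
Proof. by move=> mA; apply: limr_le; exact: ultra_mass_cvg. Qed.

Lemma ultra_mass_ge0 A : measurable A -> 0 <= ultra_mass A.
Proof.
by move=> mA; apply: ultra_mass_ge => //; apply: nearW => n; exact: fine_ge0.
Qed.

Lemma ultra_mass0 : ultra_mass set0 = 0.
Proof.
apply/le_anti; rewrite ultra_mass_ge0// andbT.
by apply: ultra_mass_le => //; apply: nearW => n; rewrite measure0.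
Qed.

Lemma ultra_massT : ultra_mass setT = 1.
Proof.
apply/le_anti/andP; split; [apply: ultra_mass_le|apply: ultra_mass_ge] => //;
  by apply: nearW => n; rewrite probability_setT.
Qed.

Lemma ultra_massS A B : measurable A -> measurable B -> A `<=` B ->
  ultra_mass A <= ultra_mass B.
Proof.
move=> mA mB AB; apply: (@ler_cvg_to _ U _ _ _ _ _ _ (ultra_mass_cvg mA) (ultra_mass_cvg mB)).
apply: nearW => n; apply: fine_le; rewrite ?fin_num_measure//.
by apply: le_measure; rewrite ?inE.
Qed.

Lemma ultra_massU A B : measurable A -> measurable B -> A `&` B = set0 ->
  ultra_mass (A `|` B) = ultra_mass A + ultra_mass B.
Proof.
move=> mA mB AB; apply/cvg_lim => //.
rewrite (_ : (fun n => _) =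
    (fun n => fine (mn n A)) \+ (fun n => fine (mn n B))).
  by apply: cvgD; exact: ultra_mass_cvg.
by apply/funext => n /=; rewrite measureU// fineD ?fin_num_measure.
Qed.

Lemma ultra_massU_le A B : measurable A -> measurable B ->
  ultra_mass (A `|` B) <= ultra_mass A + ultra_mass B.
Proof.
move=> mA mB; have -> : A `|` B = A `|` (B `\` A).
  by apply/seteqP; split=> x /=; case: (pselect (A x)); tauto.
rewrite ultra_massU//; last 2 first.
- exact: measurableD.
- by apply/seteqP; split=> x //= [? []].
rewrite lerD2l; apply: ultra_massS => //; exact: measurableD.
Qed.

Lemma ultra_massC A : measurable A -> ultra_mass (~` A) = 1 - ultra_mass A.
Proof.
move=> mA; rewrite -ultra_massT -(setUCr A) ultra_massU ?setICr//.
  by rewrite addrAC subrr add0r.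
exact: measurableC.
Qed.

End ultralimit_mass.

(** * Exhaustion of open sets from inside *)

Section inner_parts.
Context {R : realType} {T : pseudoPMetricType R}.
Implicit Types O : set T.

(* The points of [O] at distance more than [1/(k+1)] from its complement. *)
Definition inner O (k : nat) : set T :=
  [set z | exists2 e : R, k.+1%:R^-1 < e & ball z e `<=` O].

Lemma inner_sub O k : inner O k `<=` O.
Proof. by move=> z [e ke]; apply; apply: ballxx; apply: lt_trans ke. Qed.

Lemma inner_open O k : open (inner O k).
Proof.
rewrite openE => z [e ke zO]; apply/nbhs_ballP.
exists ((e - k.+1%:R^-1) / 2); first by rewrite /= divr_gt0// subr_gt0.
move=> y zy; exists ((e + k.+1%:R^-1) / 2); first by rewrite ltr_pdivlMr// mulr_natr mulr2n ltrD2r.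
apply: subset_trans zO => x yx.
have -> : e = (e - k.+1%:R^-1) / 2 + (e + k.+1%:R^-1) / 2.
  by field.
exact: ball_triangle yx.
Qed.

(** The gap between consecutive thresholds absorbs the distance from [z] to a nearby point of
    [inner O k]. A closed set thus fits between consecutive layers, and its complement is an open
    set disjoint from the smaller layer. *)
Lemma closure_inner O k : closure (inner O k) `<=` inner O k.+1.
Proof.
move=> z clz; pose r : R := (k.+1%:R^-1 - k.+2%:R^-1).
have r0 : 0 < r by rewrite subr_gt0 ltf_pV2 ?posrE// ltr_nat.
have [y [[e ke yO] zy]] := clz (ball z r) (nbhsx_ballx _ _ r0).
exists (e - r); first by rewrite ltrBrDr addrC subrK.
move=> x zx; apply: yO; rewrite -(subrK r e) addrC.
by apply: ball_triangle zx; apply: ball_sym.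
Qed.

Lemma inner_homo O : {homo inner O : j k / (j <= k)%N >-> j `<=` k}.
Proof.
apply: (homo_leq (@subset_refl _) (@subset_trans _)) => k.
exact: subset_trans (@subset_closure _ _) (@closure_inner O k).
Qed.

Lemma bigcup_inner O : open O -> \bigcup_k inner O k = O.
Proof.
rewrite openE => oO; apply/seteqP; split=> [z [k _]|z /oO]; first exact: inner_sub.
move=> /nbhs_ballP[e /= e0 zO].
have [k _ ke] := near_infty_natSinv_lt (PosNum e0).
exists k => //; exists e => //; exact: (ke k (leqnn k)).
Qed.

End inner_parts.

(** * Countably additive regularization of a content on open sets *)

Section open_content_extension.
Context {R : realType} {T : pseudoPMetricType R}.
Variable p : set T -> R.
Hypotheses (p0 : p set0 = 0) (pT : p setT = 1).
Hypothesis p_ge0 : forall A, open A -> 0 <= p A.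
Hypothesis pS : forall A B, open A -> open B -> A `<=` B -> p A <= p B.
Hypothesis pU_le : forall A B, open A -> open B -> p (A `|` B) <= p A + p B.
Hypothesis pU_ge : forall A B, open A -> open B -> A `&` B = set0 ->
  p A + p B <= p (A `|` B).
Hypothesis p_tight : forall O : nat -> set T, (forall n, open (O n)) ->
  (forall n, O n `<=` O n.+1) -> \bigcup_n O n = setT ->
  forall e, 0 < e -> exists n, 1 - e <= p (O n).

(* The value [+oo] off the open sets makes [mu_ext q] an infimum over countable
   open covers. *)
Let q (A : set (borel_of T)) : \bar R :=
  if `[< open (A : set T) >] then (p A)%:E else +oo%E.

Let qE (A : set T) : open A -> q A = (p A)%:E.
Proof. by move=> oA; rewrite /q asboolT. Qed.

Let q0 : q set0 = 0%E.
Proof. by rewrite qE ?p0//; exact: open0. Qed.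

Let q_ge0 A : (0 <= q A)%E.
Proof. by rewrite /q; case: asboolP => // oA; rewrite lee_fin p_ge0. Qed.

Let mu : {outer_measure set (borel_of T) -> \bar R} :=
  HB.pack (mu_ext q) (@isOuterMeasure.Build R (borel_of T) (mu_ext q)
    (mu_ext0 q0 q_ge0) (mu_ext_ge0 q_ge0) (@le_mu_ext _ _ _ q)
    (mu_ext_sigma_subadditive q_ge0)).

Let mu_cover_le (A : set T) (F : nat -> set T) :
  (forall i, open (F i)) -> A `<=` \bigcup_i F i ->
  (mu A <= \sum_(i <oo) (p (F i))%:E)%E.
Proof.
move=> oF AF; apply: ereal_inf_lbound; exists F; last first.
  by apply: eq_eseriesr => i _; exact: qE.
by split => // i; exact: sub_sigma_algebra.
Qed.

Let mu_ge (A : set T) (x : \bar R) :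
  (forall F : nat -> set T, (forall i, open (F i)) -> A `<=` \bigcup_i F i ->
    (x <= \sum_(i <oo) (p (F i))%:E)%E) -> (x <= mu A)%E.
Proof.
move=> h; apply: le_ereal_inf_tmp => _ [F [_ AF] <-].
have [oF|] := pselect (forall i, open (F i : set T)).
  rewrite (_ : (\sum_(i <oo) q (F i) = \sum_(i <oo) (p (F i))%:E)%E); first exact: h.
  by apply: eq_eseriesr => i _; exact: qE.
move=> /existsNP[i noF]; rewrite (@eseries_pinfty _ _ _ i) ?leey//.
- by move=> n _; rewrite -ltNye (lt_le_trans _ (q_ge0 _)).
- by rewrite /q asboolF.
Qed.

Let mu_open_le (O : set T) : open O -> (mu O <= (p O)%:E)%E.
Proof.
move=> oO; apply: le_trans
  (@mu_cover_le O (fun n => if n is 0%N then O else set0) _ _) _.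
- by case=> // n; exact: open0.
- by move=> z Oz; exists 0%N.
rewrite nneseries_recl//; last by case=> [|n] _; rewrite ?p0 ?lee_fin ?p_ge0.
rewrite eseries_cond/= eseries0 ?adde0// => -[|n]// _ _.
by rewrite p0.
Qed.

Section open_caratheodory.
Variables (V O : set T).
Hypotheses (oV : open V) (oO : open O).

Let a k := p (V `&` inner O k).

Let oVO k : open (V `&` inner O k).
Proof. by apply: openI => //; exact: inner_open. Qed.

Let a_homo : {homo a : j k / (j <= k)%N >-> j <= k}.
Proof. by move=> j k jk; apply: pS => //; apply: setIS; exact: inner_homo. Qed.

(** The rings are open and two layers wide, so consecutive ones overlap: rings one layer wide could
    miss boundary points of the layers. The sum of their contents therefore telescopes with stride
    two, whence the four terms in [sum_ring]. *)
Let ring k := inner O k.+2 `\` closure (inner O k).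

Let oring k : open (V `&` ring k).
Proof.
apply: openI => //; rewrite /ring setDE; apply: openI; first exact: inner_open.
by apply: closed_openC; exact: closed_closure.
Qed.

Let p_ring k : p (V `&` ring k) <= a k.+2 - a k.
Proof.
rewrite lerBrDr; apply: le_trans (pU_ge _ _ _) _ => //.
  apply/seteqP; split=> // z [[_ [_ nz]] [_ kz]]; apply: nz.
  exact: subset_closure.
apply: pS => //; first exact: openU.
move=> z [[Vz [kz _]]|[Vz kz]]; split => //.
by apply: inner_homo kz; rewrite (leq_trans (leqnSn _)).
Qed.

Let sum_ring k n : \sum_(j < n) p (V `&` ring (k + j)) <=
  a (k + n) + a (k + n).+1 - a k - a k.+1.
Proof.
elim: n => [|n ih]; first by rewrite big_ord0 addn0; lra.
rewrite big_ord_recr/= addnS; have := p_ring (k + n); lra.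
Qed.

Let cover_ring k :
  V `&` O `<=` (V `&` inner O k.+2) `|` \bigcup_j (V `&` ring (k + j)).
Proof.
move=> z [Vz]; rewrite -{1}(bigcup_inner oO) => -[m0 _ m0z].
have ex : exists m, `[< inner O m z >] by exists m0; apply/asboolP.
case: (ex_minnP ex) => m /asboolP mz mmin.
have [mk|km] := leqP m k.+2; first by left; split => //; exact: inner_homo mz.
right; exists (m - k.+2)%N => //; split => //.
have -> : (k + (m - k.+2))%N = m.-2 by lia.
split; first by rewrite prednK ?prednK//; lia.
move=> /closure_inner => h.
have : (m <= m.-2.+1)%N by apply: mmin; apply/asboolP.
lia.
Qed.

(** [V] is cut at a deep layer of [O]. The inner part and the complement of the closure of that
    layer are disjoint open subsets of [V], so superadditivity applies; what is left of [V] inside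
    [O] is covered by rings of total content at most [e]. *)
Lemma open_content_split : (mu (V `&` O) + mu (V `&` ~` O) <= (p V)%:E)%E.
Proof.
apply/lee_addgt0Pr => e e0.
have haS : has_sup (range a).
  split; first by exists (a 0), 0%N.
  by exists (p V) => _ [k _ <-]; apply: pS => //; exact: subIsetl.
(* The telescoped ring sum is at most twice the gap between [sup (range a)] and [a k], so a gap of
   [e / 2] suffices. *)
have e20 : 0 < e / 2 by rewrite divr_gt0.
have [_ [k _ <-] ak] := sup_adherent e20 haS.
have a_sup j : a j <= sup (range a) by apply: ub_le_sup; [exact: haS.2|exists j].
have oE : open (V `&` ~` closure (inner O k.+2)).
  by apply: openI => //; apply: closed_openC; exact: closed_closure.
have outer : (mu (V `&` ~` O) <= (p (V `&` ~` closure (inner O k.+2)))%:E)%E.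
  apply: le_trans (mu_open_le oE); apply: le_outer_measure; apply: setIS.
  by apply: subsetC; apply: subset_trans (@closure_inner _ _ _ _) _; exact: inner_sub.
have innr : (mu (V `&` O) <= (a k.+2)%:E + e%:E)%E.
  apply: le_trans (le_outer_measure mu _ _ (@cover_ring k)) _.
  apply: le_trans (outer_measureU2 _ _ _) _; apply: leeD; first exact: mu_open_le.
  apply: le_trans (@mu_cover_le _ _ (fun j => oring (k + j)) (@subset_refl _ _)) _.
  apply: lime_le.
    by apply: is_cvg_nneseries => j _ _; rewrite lee_fin p_ge0.
  apply: nearW => n; rewrite big_mkord sumEFin lee_fin.
  apply: le_trans (sum_ring k n) _.
  have := a_sup (k + n)%N; have := a_sup (k + n).+1; have := a_homo (leqnSn k).
  lra.
apply: le_trans (leeD innr outer) _; rewrite -!EFinD lee_fin addrAC lerD2r.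
apply: le_trans (pU_ge _ _ _) _ => //.
  apply/seteqP; split=> // z [[_ kz] [_ nz]]; apply: nz.
  exact: subset_closure.
by apply: pS => //; [exact: openU|move=> z [[]|[]]].
Qed.

End open_caratheodory.

(** The outer measure of an arbitrary test set is an infimum over its open covers, so it suffices to
    split each member of a cover, which is [open_content_split]. *)
Let open_caratheodory (O : set T) : open O -> caratheodory_measurable mu O.
Proof.
move=> oO; apply: le_caratheodory_measurable => A; apply: mu_ge => F oF AF.
have sub (B : set T) : (mu (A `&` B) <= \sum_(i <oo) mu (F i `&` B))%E.
  apply: le_trans (outer_measure_sigma_subadditive mu _).
  by apply: le_outer_measure; rewrite -setI_bigcupl; exact: setSI.
apply: le_trans (leeD (sub O) (sub (~` O))) _.
rewrite -nneseriesD; [|by move=> *; exact: outer_measure_ge0..].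
apply: lee_nneseries => [i _ _|i _].
  by rewrite adde_ge0//; exact: outer_measure_ge0.
exact: open_content_split.
Qed.

(** Tightness enters here. The finite unions of a countable open cover increase to the whole space,
    so one of them has content at least [1 - e], and finite subadditivity bounds the sum over the
    cover from below. *)
Let muT : mu [set: T] = 1%E.
Proof.
apply/eqP; rewrite eq_le; apply/andP; split.
  by rewrite -[leRHS]/(1%:E) -pT; apply: mu_open_le; exact: openT.
apply: mu_ge => F oF FT; apply/lee_addgt0Pr => e e0.
pose O n := \big[setU/set0]_(i < n) F i.
have oO n : open (O n).
  by rewrite /O -bigcup_mkord; apply: bigcup_open => i _.
have OS n : O n `<=` O n.+1 by rewrite /O big_ord_recr/=; exact: subsetUl.
have OT : \bigcup_n O n = setT.
  apply/seteqP; split=> // z /FT[i _ Fz]; exists i.+1 => //.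
  by rewrite /O big_ord_recr/=; right.
have [n] := p_tight oO OS OT e0.
rewrite lerBlDr -lee_fin EFinD => /le_trans; apply; rewrite leeD2r//.
have : p (O n) <= \sum_(i < n) p (F i).
  rewrite /O; elim: n => [|n ih]; first by rewrite !big_ord0 p0.
  rewrite !big_ord_recr/=; apply: le_trans (lerD ih (lexx _)).
  by apply: pU_le => //; exact: oO.
rewrite -lee_fin => /le_trans; apply; rewrite -sumEFin.
rewrite -(big_mkord xpredT (fun i => (p (F i))%:E)).
by apply: nneseries_lim_ge => i _ _; rewrite lee_fin p_ge0.
Qed.

(** Mass may move to the boundary of an open set in the limit, so only an inequality on open sets
    can be expected. Between measures of equal total mass this suffices for weak convergence. *)
Lemma open_content_extension :
  exists m : probability (borel_of T) R,
    forall O : set T, open O -> (m O <= (p O)%:E)%E.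
Proof.
pose f : set (borel_of T) -> \bar R := mu.
have borel_cara : @measurable _ (borel_of T) `<=` mu.-cara.-measurable.
  apply: smallest_sub; last by move=> O oO; exact: open_caratheodory.
  split => //; first by move=> X mX; rewrite setTD; exact: measurableC.
  by move=> F mF; exact: bigcupT_measurable.
have f_sigma : semi_sigma_additive f.
  move=> F mF tF mUF.
  apply: caratheodory_measure_sigma_additive => //; last exact: borel_cara.
  by move=> i; exact: (borel_cara _ (mF i)).
pose m := isMeasure.Build _ (borel_of T) R f
  (outer_measure0 mu) (outer_measure_ge0 mu) f_sigma.
pose M : {measure set (borel_of T) -> \bar R} := HB.pack f m.
pose P : probability (borel_of T) R :=
  HB.pack (Measure.sort M) (Measure_isProbability.Build _ (borel_of T) R M muT).
by exists P => O oO; exact: mu_open_le.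
Qed.

End open_content_extension.

(** * Weak convergence *)

Section layer_cake.
Context {d} {T : measurableType d} {R : realType} (P : probability T R).

Lemma bounded_integrable (f : T -> R) (M : R) : measurable_fun setT f ->
  (forall z, `|f z| <= M) -> P.-integrable setT (EFin \o f).
Proof.
move=> mf fM; apply: measurable_bounded_integrable => //.
  by rewrite -ge0_fin_numE ?fin_num_measure.
exists M; split; first exact: num_real.
by move=> x Mx z _; apply: le_trans (fM z) _; exact: ltW.
Qed.

Lemma probability_Rintegral_cst (r : R) : \int[P]_z r = r.
Proof.
by rewrite Rintegral_cst// [X in fine X](@probability_setT _ _ _ P) mulr1.
Qed.

Lemma step_Rintegral (A : nat -> set T) (h : R) n :
  (forall j, measurable (A j)) ->
  P.-integrable setT (EFin \o (fun z => \sum_(j < n) h * \1_(A j) z)) /\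
  \int[P]_z (\sum_(j < n) h * \1_(A j) z) = \sum_(j < n) h * fine (P (A j)).
Proof.
move=> mA; have intA j : P.-integrable setT (EFin \o (fun z => h * \1_(A j) z)).
  apply: (@bounded_integrable _ `|h|).
    by apply: measurable_funM => //; exact: measurable_indic.
  move=> z; rewrite normrM ler_piMr// indicE.
  by case: (_ \in _); rewrite ?normr1 ?normr0.
elim: n => [|n [ih1 ih2]].
  split.
    apply: (@bounded_integrable _ 0) => [|z].
      by under eq_fun do rewrite big_ord0; exact: measurable_cst.
    by rewrite big_ord0 normr0.
  rewrite big_ord0; under eq_Rintegral do rewrite big_ord0.
  by rewrite Rintegral_cst// mul0r.
split.
  rewrite (_ : EFin \o _ =
      (EFin \o (fun z => \sum_(j < n) h * \1_(A j) z)) \+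
      (EFin \o (fun z => h * \1_(A n) z))); first exact: integrableD.
  by apply/funext => z; rewrite /= big_ord_recr.
rewrite big_ord_recr/=; under eq_Rintegral do rewrite big_ord_recr/=.
rewrite RintegralD// ih2 RintegralZl//; last exact: integrable_indic.
by rewrite /Rintegral integral_indic// setIT.
Qed.

(** For [h > 0] the sum is [x] rounded up to a multiple of [h] and truncated at [n%:R * h];
    [step_ge] is the matching lower bound. *)
Lemma step_le (x h : R) n : 0 <= h -> 0 <= x ->
  \sum_(j < n) h * (j%:R * h < x)%R%:R <= x + h.
Proof.
move=> h0 x0; elim: n => [|n ih]; first by rewrite big_ord0 addr_ge0.
rewrite big_ord_recr/=; case: ltP => [nhx|_]; last by rewrite mulr0 addr0.
rewrite mulr1 lerD2r; apply: le_trans (ltW nhx).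
have -> : n%:R * h = \sum_(j < n) h by rewrite sumr_const card_ord mulr_natl.
by apply: ler_sum => j _; case: ltP; rewrite ?mulr1 ?mulr0.
Qed.

Lemma step_ge (x h : R) n : 0 <= h -> x <= n%:R * h ->
  x <= \sum_(j < n) h * (j%:R * h < x)%R%:R.
Proof.
(* The bound [x <= n%:R * h] does not pass to smaller [n]; the truncated statement does, and so it
   supports the induction. *)
move=> h0; suff : Num.min x (n%:R * h) <= \sum_(j < n) h * (j%:R * h < x)%R%:R.
  by move=> + xn; rewrite (min_idPl xn).
elim: n => [|n ih]; first by rewrite big_ord0 mul0r ge_min lexx orbT.
rewrite big_ord_recr/=; case: ltP => [nhx|xnh] in ih *.
  rewrite ge_min; apply/orP; right.
  by rewrite -natr1 mulrDl mul1r mulr1 lerD2r.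
by rewrite mulr0 addr0 ge_min ih.
Qed.

Variables (g : T -> R) (h : R) (n : nat).
Hypotheses (mg : measurable_fun setT g) (h0 : 0 <= h) (g0 : forall z, 0 <= g z)
  (gn : forall z, g z <= n%:R * h).

Let A j := [set z | j%:R * h < g z].

Let mA j : measurable (A j).
Proof.
rewrite (_ : A j = g @^-1` `]j%:R * h, +oo[%classic).
  by rewrite -[X in measurable X]setTI; apply: mg => //; exact: measurable_itv.
by apply/seteqP; split=> z; rewrite /A /= in_itv/= andbT.
Qed.

Let memA j z : (z \in A j) = (j%:R * h < g z).
Proof. by apply/idP/idP; rewrite inE. Qed.

Let intg : P.-integrable setT (EFin \o g).
Proof.
by apply: (@bounded_integrable _ (n%:R * h)) => // z; rewrite ger0_norm.
Qed.

(** Discrete layer cake: with [layer_le], the integral of [g] is known up to [h] from the masses of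
    finitely many superlevel sets, which are open when [g] is continuous. *)
Lemma layer_ge :
  \int[P]_z (g z) <= \sum_(j < n) h * fine (P [set z | j%:R * h < g z]%R).
Proof.
have [iA <-] := step_Rintegral h n mA.
apply: le_Rintegral => // z _; apply: le_trans (step_ge h0 (gn z)) _.
by apply: ler_sum => j _; rewrite indicE memA.
Qed.

Lemma layer_le :
  \sum_(j < n) h * fine (P [set z | j%:R * h < g z]%R) <= \int[P]_z (g z) + h.
Proof.
have [iA <-] := step_Rintegral h n mA.
rewrite -[X in _ <= _ + X]probability_Rintegral_cst -RintegralD//; last exact: finite_measure_integrable_cst.
apply: le_Rintegral => //.
  apply: (@bounded_integrable _ (n%:R * h + h)); first exact: measurable_funD.
  by move=> z; rewrite ger0_norm ?addr_ge0// lerD2r.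
move=> z _; apply: le_trans (step_le _ h0 (g0 z)).
by apply: ler_sum => j _; rewrite indicE memA.
Qed.

End layer_cake.

Lemma continuous_borel_measurable {R : realType} {T : ptopologicalType}
    (f : T -> R) : continuous f -> measurable_fun setT (f : borel_of T -> R).
Proof.
move=> cf; apply: (measurability _ (RGenOpens.measurableE R)) => //.
move=> _ [_ [a [b ->]] <-]; rewrite setTI; apply: sub_sigma_algebra.
by apply: open_comp; [move=> z _; exact: cf|exact: interval_open].
Qed.

(** Superlevel sets of a continuous function are open, so the layer-cake sum for [m] is at most the
    limit of those for [mn n]. This gives one inequality ([half]); the other is the same inequality
    for the opposite function. *)
Lemma portmanteau_ultra {R : realType} {T : ptopologicalType}
    (U : set_system nat) (UU : UltraFilter U)
    (mn : nat -> probability (borel_of T) R) (m : probability (borel_of T) R) :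
  (forall O : set T, open O -> fine (m O) <= ultra_mass U mn O) ->
  forall (f : T -> R) (M : R), continuous f -> (forall z, `|f z| <= M) ->
  (fun n => \int[mn n]_z (f z)) @ U --> \int[m]_z (f z).
Proof.
move=> mO.
suff half (f : T -> R) (M e : R) : continuous f -> (forall z, `|f z| <= M) ->
    0 < e -> \forall n \near U, \int[m]_z (f z) <= \int[mn n]_z (f z) + e.
  move=> f M cf fM; apply/cvgrPdist_le => e e0.
  have Nf (P : probability (borel_of T) R) :
      \int[P]_z (- f z) = - \int[P]_z (f z).
    under eq_Rintegral do rewrite -mulN1r.
    rewrite RintegralZl ?mulN1r//; apply: (@bounded_integrable _ _ _ _ _ M) => //.
    exact: continuous_borel_measurable.
  have h1 := half f M e cf fM e0.
  have h2 : \forall n \near U, \int[m]_z (- f z) <= \int[mn n]_z (- f z) + e.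
    apply: (half _ M) => // [z|z]; first by apply: cvgN; exact: cf.
    by rewrite normrN.
  near=> n; rewrite ler_distl; apply/andP; split.
    rewrite lerBlDr; have : \int[m]_z (- f z) <= \int[mn n]_z (- f z) + e by near: n.
    by rewrite !Nf; lra.
  by near: n.
move=> cf fM e0.
(* The layer cake requires a nonnegative function. The shift cancels at the end because all the
   measures have total mass one ([gE]). *)
pose g z := f z + M.
have g0 z : 0 <= g z by have := fM z; rewrite ler_norml /g; lra.
have cg : continuous g by move=> z; apply: cvgD; [exact: cf|exact: cvg_cst].
have mg := continuous_borel_measurable cg.
(* One [h] is lost in replacing the limit of the sums by a sum for [mn k], another in returning from
   that sum to an integral. *)
pose h := e / 2; have h0 : 0 < h by rewrite divr_gt0.
pose n := Num.bound (2 * M / h).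
have M0 : 0 <= M by apply: le_trans (fM point).
have gn z : g z <= n%:R * h.
  have A0 : 0 <= 2 * M / h by apply: divr_ge0; [exact: mulr_ge0|exact: ltW].
  rewrite -ler_pdivrMr//; apply: le_trans (ltW (archi_boundP A0)).
  by rewrite ler_pM2r ?invr_gt0// /g; have := fM z; rewrite ler_norml; lra.
have gE (P : probability (borel_of T) R) : \int[P]_z (g z) = \int[P]_z (f z) + M.
  rewrite RintegralD// ?probability_Rintegral_cst//.
  - apply: (@bounded_integrable _ _ _ _ _ M) => //.
    exact: continuous_borel_measurable.
  - exact: finite_measure_integrable_cst.
pose A j := [set z | j%:R * h < g z].
have oA j : open (A j).
  by apply: (@open_comp _ _ g [set x | j%:R * h < x]) => [z _|]; [exact: cg|exact: open_gt].
have mA j : measurable (A j : set (borel_of T)) by exact: sub_sigma_algebra.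
have lim_sum : (fun k => \sum_(j < n) h * fine (mn k (A j))) @ U -->
    \sum_(j < n) h * ultra_mass U mn (A j).
  apply: cvg_big => [|j _]; first exact: add_continuous.
  by apply: cvgM; [exact: cvg_cst|exact: ultra_mass_cvg].
have lo : \int[m]_z (g z) <= \sum_(j < n) h * ultra_mass U mn (A j).
  apply: le_trans (layer_ge m mg (ltW h0) g0 gn) _.
  by apply: ler_sum => j _; rewrite ler_pM2l//; exact: (mO _ (oA j)).
have : \forall k \near U, \sum_(j < n) h * ultra_mass U mn (A j) - h <
    \sum_(j < n) h * fine (mn k (A j)).
  by apply: (cvgr_gt _ lim_sum); rewrite ltrBlDr ltrDl.
apply: filterS => k /= kU.
have hi := layer_le (mn k) mg (ltW h0) g0 gn.
have := gE m; have := gE (mn k); have : h + h = e by rewrite /h; lra.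
rewrite -/(A _) in hi.
lra.
Unshelve. all: by end_near. Qed.

(** * Strong law of large numbers *)

Lemma exists_sqr_between (m : nat) : (0 < m)%N ->
  exists k, (k.+1 ^ 2 <= m < k.+2 ^ 2)%N.
Proof.
elim: m => // -[_ _|m /(_ isT)[k /andP[km mk]] _]; first by exists 0%N.
have [h|h] := leqP (k.+2 ^ 2) m.+2; last by exists k; rewrite h (leqW km).
by exists k.+1; rewrite h/=; nia.
Qed.

Section slln.
Context {d} {T : measurableType d} {R : realType} (P : probability T R).
Variables (B : nat -> set T) (p : R).
Hypotheses (mB : forall i, measurable (B i)) (PB : forall i, P (B i) = p%:E).
Hypothesis PBI : forall i j, i != j -> P (B i `&` B j) = (p ^+ 2)%:E.

Let S n z : R := \sum_(i < n) \1_(B i) z.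

Let p_itv : 0 <= p <= 1.
Proof. by have := fine_probability_itv P (mB 0); rewrite PB. Qed.

Let S_ge0 n z : 0 <= S n z.
Proof. by apply: sumr_ge0 => i _. Qed.

Let S_le n z : S n z <= n%:R.
Proof.
have -> : n%:R = \sum_(i < n) 1 :> R by rewrite sumr_const card_ord.
by apply: ler_sum => i _; rewrite indicE; case: (_ \in _).
Qed.

Let S_homo z : {homo S^~ z : n m / (n <= m)%N >-> n <= m}.
Proof.
apply: (homo_leq (@lexx _ _) le_trans) => n.
by rewrite /S big_ord_recr/= lerDl.
Qed.

Let mS n : measurable_fun setT (S n).
Proof. by apply: measurable_sum => i; exact: measurable_indic. Qed.

Let intX (f : T -> R) (M : R) := @bounded_integrable _ _ _ P f M.

Let S_Rintegral n : \int[P]_z (S n z) = n%:R * p.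
Proof.
have [_] := step_Rintegral P 1 n mB.
under eq_Rintegral do under eq_bigr do rewrite mul1r.
move=> ->; under eq_bigr do rewrite mul1r PB.
by rewrite sumr_const card_ord mulr_natl.
Qed.

Let SB_Rintegral n : \int[P]_z (S n z * \1_(B n) z) = n%:R * p ^+ 2.
Proof.
have [_] := step_Rintegral P 1 n (fun i => measurableI _ _ (mB i) (mB n)).
under eq_Rintegral => z _.
  under eq_bigr do rewrite mul1r indicI.
  rewrite -mulr_suml; over.
move=> ->; under eq_bigr => i _ do rewrite mul1r PBI ?ltn_eqF//.
by rewrite sumr_const card_ord mulr_natl.
Qed.

Let dev n z := (S n z - n%:R * p) ^+ 2.

Let int_dev n : P.-integrable setT (EFin \o dev n).
Proof.
apply: (@intX _ ((n%:R + n%:R) ^+ 2)).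
  by apply: measurable_funX; apply: measurable_funB => //; exact: measurable_cst.
move=> z; rewrite /dev normrX lerXn2r ?nnegrE ?addr_ge0//.
apply: le_trans (ler_normB _ _) _; rewrite !ger0_norm ?S_ge0//.
- by case/andP: p_itv => p0 p1; rewrite lerD ?S_le// ler_piMr.
- by case/andP: p_itv => p0 p1; rewrite mulr_ge0.
Qed.

(** Induction on [n]. As an indicator is idempotent, expanding the square makes the increment of
    [dev] a combination of [S n * b], [S n], [b] and a constant, all with known integrals; only
    pairwise independence enters. *)
Let variance_S n : \int[P]_z (dev n z) = n%:R * (p - p ^+ 2).
Proof.
elim: n => [|n ih].
  under eq_Rintegral do rewrite /dev /S big_ord0 mul0r subr0 expr0n.
  by rewrite probability_Rintegral_cst mul0r.
pose b : T -> R := \1_(B n).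
have bb z : b z * b z = b z.
  by rewrite /b indicE; case: (_ \in _); rewrite ?mulr1 ?mulr0.
pose g1 z := 2 * (S n z * b z).
pose g2 z := (- 2 * p) * S n z.
pose g3 z := (1 - 2 * n%:R * p - 2 * p) * b z.
pose c := 2 * n%:R * p ^+ 2 + p ^+ 2.
have devE z : dev n.+1 z = dev n z + g1 z + g2 z + g3 z + c.
  rewrite /dev /S big_ord_recr/= -/(S n z) -/(b z) /g1 /g2 /g3 /c -natr1.
  by have := bb z => bbz; ring: bbz.
have mb : measurable_fun setT b by exact: measurable_indic.
have iS : P.-integrable setT (EFin \o S n).
  by apply: (@intX _ n%:R) => // z; rewrite ger0_norm.
have ib : P.-integrable setT (EFin \o b) by exact: integrable_indic.
have iSb : P.-integrable setT (EFin \o (fun z => S n z * b z)).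
  apply: (@intX _ n%:R) => [|z]; first exact: measurable_funM.
  by rewrite ger0_norm ?mulr_ge0// /b indicE; case: (_ \in _); rewrite ?mulr1 ?mulr0.
have i1 : P.-integrable setT (EFin \o g1) by exact: (integrableZl measurableT _ iSb).
have i2 : P.-integrable setT (EFin \o g2) by exact: (integrableZl measurableT _ iS).
have i3 : P.-integrable setT (EFin \o g3) by exact: (integrableZl measurableT _ ib).
have i01 : P.-integrable setT (EFin \o (fun z => dev n z + g1 z)).
  exact: (integrableD measurableT (int_dev n) i1).
have i02 : P.-integrable setT (EFin \o (fun z => dev n z + g1 z + g2 z)).
  exact: (integrableD measurableT i01 i2).
have i03 : P.-integrable setT (EFin \o (fun z => dev n z + g1 z + g2 z + g3 z)).
  exact: (integrableD measurableT i02 i3).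
under eq_Rintegral do rewrite devE.
rewrite RintegralD//; last exact: finite_measure_integrable_cst.
rewrite RintegralD// RintegralD// RintegralD// ih !RintegralZl//.
rewrite probability_Rintegral_cst S_Rintegral SB_Rintegral.
have -> : \int[P]_z b z = p.
  by rewrite -[RHS]/(fine p%:E) -(PB n) /Rintegral integral_indic// setIT.
by rewrite /c -natr1; ring.
Qed.

Let low (e : R) n := [set z | S n z <= n%:R * (p - e)].

Let mlow e n : measurable (low e n).
Proof.
rewrite (_ : low e n = S n @^-1` `]-oo, n%:R * (p - e)]%classic).
  by rewrite -[X in measurable X]setTI; apply: mS => //; exact: measurable_itv.
by apply/seteqP; split=> z; rewrite /low /= in_itv.
Qed.

(** Chebyshev: on [low e n] the deviation is at least [n%:R * e], while the variance is at most
    [n%:R]. *)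
Let P_low (e : R) n : 0 < e -> (0 < n)%N -> fine (P (low e n)) <= (e ^+ 2)^-1 / n%:R.
Proof.
move=> e0 n0; have n0' : 0 < n%:R :> R by rewrite ltr0n.
have ne0 : 0 < (n%:R * e) ^+ 2 by rewrite exprn_gt0// mulr_gt0.
have : \int[P]_z ((n%:R * e) ^+ 2 * \1_(low e n) z) <= \int[P]_z (dev n z).
  apply: le_Rintegral => //.
    exact: (integrableZl measurableT _ (integrable_indic P (mlow e n))).
  move=> z _; rewrite indicE; case: (boolP (z \in _)); last first.
    by rewrite mulr0 sqr_ge0.
  rewrite inE mulr1 /low/= => Sz; rewrite /dev -[leRHS]sqrrN.
  rewrite lerXn2r ?nnegrE ?mulr_ge0 ?(ltW e0)//; last lra.
  by have : 0 <= n%:R * e; [rewrite mulr_ge0// ltW|lra].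
rewrite RintegralZl//; last exact: integrable_indic.
rewrite variance_S {1}/Rintegral integral_indic// setIT => h.
rewrite -(ler_pM2l ne0); apply: le_trans h _.
have -> : (n%:R * e) ^+ 2 * ((e ^+ 2)^-1 / n%:R) = n%:R :> R by field; rewrite !gt_eqF.
rewrite ler_piMr//; case/andP: p_itv => p0 p1.
by have := sqr_ge0 p; lra.
Qed.

(** The subtracted term carries the induction: the next summand is at most the difference of
    consecutive inverses. *)
Let sum_inv_sqr n : \sum_(k < n.+1) ((k.+1 ^ 2)%:R)^-1 <= 2 - n.+1%:R^-1 :> R.
Proof.
elim: n => [|n ih]; first by rewrite big_ord_recr big_ord0/= exp1n add0r invr1 addrK.
rewrite big_ord_recr/=; apply: le_trans (lerD ih (lexx _)) _.
rewrite -addrA lerD2l addrC lerBlDr addrC.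
have n1 : 0 < n.+1%:R :> R by rewrite ltr0n.
have n2 : 0 < n.+2%:R :> R by rewrite ltr0n.
have -> : n.+1%:R^-1 - n.+2%:R^-1 = (n.+1%:R * n.+2%:R)^-1 :> R.
  move: n1 n2; rewrite -(natr1 n.+1); move: (n.+1%:R : R) => x n1 n2.
  by field; rewrite !gt_eqF.
by rewrite lef_pV2 ?posrE ?mulr_gt0 ?ltr0n// -natrM ler_nat; nia.
Qed.

(** Borel-Cantelli: the Chebyshev bound, of order [1/n], is summable along the squares. *)
Let ae_sqr (e : R) : 0 < e -> {ae P, forall z, exists K, forall k, (K <= k)%N ->
  (k.+1 ^ 2)%:R * (p - e) < S (k.+1 ^ 2) z}.
Proof.
move=> e0; pose F k := low e (k.+1 ^ 2).
have PF : P (lim_sup_set F) = 0%E.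
  apply: lim_sup_set_cvg0 => [k|]; first exact: mlow.
  pose c : R := (e ^+ 2)^-1 * 2.
  have c0 : 0 <= c by rewrite mulr_ge0 ?invr_ge0 ?sqr_ge0.
  apply: (@le_lt_trans _ _ c%:E); last exact: ltry.
  apply: lime_le; first by apply: is_cvg_nneseries.
  apply: nearW => -[|n].
    by rewrite big_geq.
  rewrite big_mkord; apply: (@le_trans _ _
      (\sum_(k < n.+1) (((e ^+ 2)^-1 / (k.+1 ^ 2)%:R)%R : R)%:E)%E).
    apply: lee_sum => k _.
    have := P_low e0 (expn_gt0 k.+1 2 : 0 < k.+1 ^ 2)%N.
    by rewrite -lee_fin fineK ?fin_num_measure.
  rewrite sumEFin lee_fin -mulr_sumr ler_wpM2l ?invr_ge0 ?sqr_ge0//.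
  apply: le_trans (sum_inv_sqr n) _.
  by rewrite gerBl invr_ge0.
exists (lim_sup_set F); split => //.
  by apply: bigcap_measurable => // k _; apply: bigcup_measurable => j _; exact: mlow.
move=> z /= /forallNP nz K _; have /existsNP[k /not_implyP[Kk /negP]] := nz K.
by rewrite -leNgt => kz; exists k.
Qed.

(** Between consecutive squares, [S] is bounded below by its value at the smaller one, and the ratio
    of the squares tends to one. Rational-type tolerances [l.+1%:R^-1] keep the union of exceptional
    sets countable. *)
Lemma slln_lower : {ae P, forall z, forall e : R, 0 < e -> exists N, forall n,
  (N <= n)%N -> p - e <= (\sum_(i < n.+1) \1_(B i) z) / n.+1%:R}.
Proof.
have inv0 l : 0 < l.+1%:R^-1 :> R by rewrite invr_gt0 ltr0n.
have := ae_foralln (fun l => ae_sqr (inv0 l)).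
apply: filterS => z hz e e0.
have e20 : 0 < e / 2 by rewrite divr_gt0.
have [l _ /(_ l (leqnn l))/= le] := near_infty_natSinv_lt (PosNum e20).
have [K hK] := hz l; set e' := l.+1%:R^-1 in le hK.
(* For [x = k.+1%:R] this yields [4 < e * x], so passing from [x ^+ 2] to [(x + 1) ^+ 2] costs at
   most [e / 2 * x ^+ 2]; the other half of [e] pays for [e']. *)
pose D := Num.bound (4 / e).
exists ((K + D).+1 ^ 2)%N => n Nn.
have [k /andP[kn nk]] := exists_sqr_between (ltn0Sn n).
have KDk : (K + D <= k)%N by nia.
have {hK} := hK k (leq_trans (leq_addr _ _) KDk).
set s := S _ z => hs.
have sS : s <= S n.+1 z by exact: S_homo.
rewrite ler_pdivlMr ?ltr0n// -/(S n.+1 z); apply: le_trans sS.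
have [pe|pe] := lerP (p - e) 0.
  by apply: le_trans (S_ge0 _ _); rewrite mulr_le0_ge0.
case/andP: p_itv => p0 p1.
have Dk : 4 / e < k.+1%:R.
  have A0 : 0 <= 4 / e by apply: divr_ge0 => //; exact: ltW.
  by apply: lt_le_trans (archi_boundP A0) _; rewrite ler_nat -/D; lia.
have n1k : n.+1%:R <= k.+2%:R ^+ 2 :> R by rewrite -natrX ler_nat ltnW.
apply: le_trans (ltW hs); rewrite natrX.
move: Dk; rewrite ltr_pdivrMr// => Dk.
rewrite -(natr1 k.+1) in n1k; set x : R := k.+1%:R in Dk n1k *.
have x1 : 1 <= x by rewrite ler1n.
apply: (@le_trans _ _ ((p - e) * (x + 1) ^+ 2)); first by rewrite ler_pM2l.
have e'x : e' * x ^+ 2 <= e / 2 * x ^+ 2 by rewrite ler_wpM2r ?sqr_ge0// ltW.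
have px : p * (2 * x + 1) <= 2 * x + 1 by rewrite ler_piMl//; lra.
have ex : 4 * x <= e * x ^+ 2.
  by rewrite expr2 mulrA [e * x]mulrC ler_wpM2r ?(ltW Dk)//; lra.
nra.
Qed.

End slln.

(** * Countable bases *)

Lemma separable_second_countable {R : realType} {T : pseudoMetricType R}
    (D : set T) : countable D -> dense D -> @second_countable T.
Proof.
move=> cD dD; pose b (k : nat) (z : T) := (ball z (k.+1%:R^-1 : R))^°.
exists (\bigcup_k (b k @` D)).
  apply: bigcup_countable => // k _.
  exact: card_le_trans (card_image_le _ _) cD.
split=> [_ [k _ [z _ <-]]|x A /nbhs_ballP[e /= e0 xA]]; first exact: open_interior.
have e20 : 0 < e / 2 by rewrite divr_gt0.
have [k _ /(_ k (leqnn k))/= ke] := near_infty_natSinv_lt (PosNum e20).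
have k0 : 0 < k.+1%:R^-1 :> R by rewrite invr_gt0 ltr0n.
set r : R := k.+1%:R^-1 in ke k0 *.
have r20 : 0 < r / 2 by rewrite divr_gt0.
have [z [xz Dz]] : ((ball x (r / 2))^° `&` D) !=set0.
  apply: dD; last exact: open_interior.
  by exists x; exact: (nbhs_singleton (nbhs_interior (nbhsx_ballx x _ r20))).
have {}xz := interior_subset xz.
exists (b k z).
  split; first by exists k => //; exists z.
  apply/nbhs_ballP; exists (r / 2) => // y xy.
  rewrite -/r (splitr r); apply: ball_triangle xy; exact: ball_sym.
move=> y /interior_subset zy; apply: xA.
have -> : e = e / 2 + e / 2 by rewrite -splitr.
apply: (@ball_triangle _ _ z).
  by apply: le_ball xz; rewrite ler_pM2r ?invr_gt0//; move: e20 ke; lra.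
by apply: le_ball zy; rewrite -/r ltW.
Qed.

Lemma second_countable_seq {T : ptopologicalType} : @second_countable T ->
  exists b : nat -> set T, (forall i, open (b i)) /\
    forall x (O : set T), open O -> O x -> exists2 i, b i x & b i `<=` O.
Proof.
move=> [B cB [oB nB]]; move: cB => /pfcard_geP[B0|[g]].
  exists (fun=> set0); split => [i|x O oO Ox]; first exact: open0.
  have [|U [BU _] _] := nB x O; first exact: open_nbhs_nbhs.
  by rewrite B0 in BU.
exists g; split => [i|x O oO Ox]; first by apply: oB; exact: funS.
have [|U [BU Ux] UO] := nB x O; first exact: open_nbhs_nbhs.
by have [i _ iU] := @surj _ _ _ _ g U BU; exists i; rewrite iU.
Qed.

(** * Empirical measures *)

Lemma emp_val {d} {T : measurableType d} {R : realType} n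
    (z : 'I_n.+1 -> T) (A : set T) :
  @emp _ T R n z A =
  ((\sum_(i < n.+1) \1_A (z i)) / n.+1%:R)%:E.
Proof.
change (((n.+1%:R : R)^-1)%:E * \sum_(k < n.+1) \d_(z (inord k : 'I_n.+1)) A =
  ((\sum_(i < n.+1) \1_A (z i)) / n.+1%:R)%:E)%E.
rewrite mulrC EFinM -sumEFin; congr (_ * _)%E; apply: eq_bigr => i _.
by rewrite inord_val diracE indicE.
Qed.

Lemma indic_le {T : Type} {R : numDomainType} (A B : set T) z :
  A `<=` B -> \1_A z <= \1_B z :> R.
Proof.
move=> AB; rewrite !indicE; case: (pselect (A z)) => [Az|nAz].
  by rewrite !mem_set//; exact: AB.
by rewrite (memNset nAz).
Qed.

Section empirical_measures.
Context {d} {Omega : measurableType d} {R : realType} (P : probability Omega R).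

Lemma iid_setI {dT} {S : measurableType dT} (Z : nat -> Omega -> S)
    (lam : probability S R) (i j : nat) (A B : set S) :
  iid P Z lam -> measurable A -> measurable B -> i != j ->
  P (Z i @^-1` A `&` Z j @^-1` B) = (lam A * lam B)%E.
Proof.
move=> iidZ mA mB ij; pose n := (maxn i j).+1.
pose D k := if k == i then A else if k == j then B else setT.
have mD k : measurable (D k) by rewrite /D; case: ifP => // _; case: ifP.
have iN : (i < n)%N by rewrite ltnS leq_maxl.
have jN : (j < n)%N by rewrite ltnS leq_maxr.
have Di : D i = A by rewrite /D eqxx.
have Dj : D j = B by rewrite /D eq_sym (negbTE ij) eqxx.
have -> : Z i @^-1` A `&` Z j @^-1` B = \bigcap_(k in `I_n) (Z k @^-1` D k).
  apply/seteqP; split=> [z [zA zB] k _|z h].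
    by rewrite /D/=; case: eqP => [->//|_]; case: eqP => [->|].
  by split; [have := h i iN|have := h j jN]; rewrite ?Di ?Dj.
rewrite (iidZ _ _ mD) (bigD1 (Ordinal iN))//= Di.
rewrite (bigD1 (Ordinal jN))/=; last by rewrite -val_eqE/= eq_sym.
rewrite Dj big1 ?mule1// => k /andP[]; rewrite -!val_eqE/= => ki kj.
by rewrite /D (negbTE ki) (negbTE kj) probability_setT.
Qed.

Lemma iid_marginal {dT} {S : measurableType dT} (Z : nat -> Omega -> S)
    (lam : probability S R) (i : nat) (A : set S) :
  iid P Z lam -> measurable A -> P (Z i @^-1` A) = lam A.
Proof.
move=> iidZ mA; have ij : i != i.+1 by rewrite neq_ltn ltnSn.
have := iid_setI iidZ mA measurableT ij.
by rewrite preimage_setT setIT probability_setT mule1.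
Qed.

(** The exceptional null set must not depend on [O]. The law of large numbers is applied to finite
    unions of basic sets, countably many since finite sequences are coded by [pickle]; any open [O]
    is an increasing union of such sets, and the lower bound passes to [O] by monotonicity. *)
Lemma empirical_open_lower {T : ptopologicalType} (Z : nat -> Omega -> borel_of T)
    (lam : probability (borel_of T) R) : @second_countable T ->
  (forall i, measurable_fun setT (Z i)) -> iid P Z lam ->
  {ae P, forall z, forall (O : set T) (e : R), open O -> 0 < e ->
    exists N, forall n, (N <= n)%N ->
      fine (lam O) - e <= (\sum_(i < n.+1) \1_O (Z i z)) / n.+1%:R}.
Proof.
move=> /second_countable_seq[b [ob basis_b]] mZ iidZ.
pose V (s : seq nat) : set T := \big[setU/set0]_(i <- s) b i.
have oV s : open (V s).
  rewrite /V -bigcup_seq; apply: bigcup_open => i _; exact: ob.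
have mV s : measurable (V s : set (borel_of T)) by exact: sub_sigma_algebra.
have aeV l : {ae P, forall z, forall e : R, 0 < e -> exists N, forall n,
    (N <= n)%N -> fine (lam (V (odflt [::] (unpickle l)))) - e <=
      (\sum_(i < n.+1) \1_(V (odflt [::] (unpickle l))) (Z i z)) / n.+1%:R}.
  set s := odflt _ _.
  have mB i : measurable (Z i @^-1` V s).
    by rewrite -[X in measurable X]setTI; exact: mZ.
  have := @slln_lower _ _ _ P (fun i => Z i @^-1` V s) (fine (lam (V s))) mB.
  apply.
    by move=> i; rewrite fineK ?fin_num_measure//; exact: iid_marginal.
  move=> i j ij; rewrite (iid_setI iidZ)// expr2 EFinM.
  by rewrite fineK ?fin_num_measure.
have := ae_foralln aeV; apply: filterS => z hz O e oO e0.
have e20 : 0 < e / 2 by rewrite divr_gt0.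
pose s k := [seq i <- iota 0 k | `[< b i `<=` O >]].
have VO k : V (s k) `<=` O.
  by rewrite /V -bigcup_seq => x [i]/=; rewrite mem_filter => /andP[/asboolP h _] /h.
have VS : {homo (fun k => V (s k)) : j k / (j <= k)%N >-> (j <= k)%O}.
  move=> j k jk; apply/subsetPset; rewrite /V -!bigcup_seq => x [i]/=.
  rewrite mem_filter mem_iota => /andP[ibO /andP[_ ij]] bix.
  exists i => //=; rewrite mem_filter ibO mem_iota/=; exact: leq_trans jk.
have VE : \bigcup_k V (s k) = O.
  apply/seteqP; split=> [x [k _ /VO]//|x Ox].
  have [i bix iO] := basis_b x O oO Ox; exists i.+1 => //.
  rewrite /V -bigcup_seq; exists i => //=.
  by rewrite mem_filter mem_iota add0n leq0n ltnSn !andbT; apply/asboolP.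
have cvgV := @nondecreasing_cvg_mu _ _ _ lam _ (fun k => mV (s k))
  (bigcupT_measurable _ (fun k => mV (s k))) VS.
rewrite VE in cvgV.
have /(fine_cvg)/cvgr_gt/(_ (fine (lam O) - e / 2)) : (lam \o (fun k => V (s k))) @ \oo --> (fine (lam O))%:E.
  by rewrite fineK// fin_num_measure//; exact: sub_sigma_algebra.
rewrite gtrBl e20 => /(_ isT) [k _ /(_ k (leqnn k))/= hk].
have [N hN] := hz (pickle (s k)) _ e20.
exists N => n /hN; rewrite pickleK/= => h.
apply: (@le_trans _ _ (fine (lam (V (s k))) - e / 2)); first by move: hk; lra.
apply: le_trans h _; rewrite ler_pM2r ?invr_gt0 ?ltr0n//.
apply: ler_sum => i _; exact: indic_le.
Qed.

End empirical_measures.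

Lemma emp_Rintegral {d} {T : measurableType d} {R : realType} n
    (z : 'I_n.+1 -> T) (f : T -> R) (M : R) :
  measurable_fun setT f -> (forall x, `|f x| <= M) ->
  \int[@emp _ T R n z]_x (f x) = (\sum_(i < n.+1) f (z i)) / n.+1%:R.
Proof.
(* The shift by [M] makes the integrand nonnegative, as the rules for integrating against scaled and
   summed measures require. *)
move=> mf fM; pose g x := f x + M.
have g0 x : 0 <= g x by have := fM x; rewrite ler_norml /g; lra.
have mg : measurable_fun setT g by apply: measurable_funD.
have gE : \int[@emp _ T R n z]_x (g x) = (\sum_(i < n.+1) g (z i)) / n.+1%:R.
  have mG : measurable_fun setT (EFin \o g) by exact/measurable_EFinP.
  have G0 x : setT x -> (0 <= (g x)%:E)%E by rewrite lee_fin.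
  rewrite /Rintegral.
  rewrite (@ge0_integral_mscale _ _ _
    (msum (fun k : nat => \d_(z (inord k))) n.+1) _ measurableT _ _ mG G0).
  rewrite ge0_integral_measure_sum//.
  under eq_bigr do rewrite integral_dirac// diracT mul1e inord_val.
  by rewrite sumEFin -EFinM mulrC.
have : \int[@emp _ T R n z]_x (g x) = \int[@emp _ T R n z]_x (f x) + M.
  rewrite RintegralD// ?probability_Rintegral_cst//.
  - exact: (@bounded_integrable _ _ _ _ _ M).
  - exact: finite_measure_integrable_cst.
rewrite gE /g big_split/= sumr_const card_ord mulrDl -[M *+ _]mulr_natr mulfK ?pnatr_eq0//.
by move=> /addIr.
Qed.

Lemma continuous_borel_fun {T S : ptopologicalType} (f : T -> S) :
  continuous f -> measurable_fun setT (f : borel_of T -> borel_of S).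
Proof.
move=> cf; have borelE : @measurable _ (borel_of S) = <<s @open S>> by [].
apply: (measurability _ borelE) => //.
move=> _ [A oA <-]; rewrite setTI; apply: sub_sigma_algebra.
by apply: open_comp => // z _; exact: cf.
Qed.

Lemma open_setXT {T S : topologicalType} (O : set T) :
  open O -> open (O `*` [set: S]).
Proof.
move=> oO; rewrite (_ : O `*` _ = fst @^-1` O).
  by apply: open_comp => // z _; exact: cvg_fst.
by apply/seteqP; split=> [z []|z].
Qed.

(** * Cylinders inside open sets of a product with a compact factor *)

Section tube.
Context {T S : topologicalType}.
Hypothesis S_compact : compact [set: S].

Lemma open_tube (O : set (T * S)) :
  open O -> open [set w | forall x, O (w, x)].
Proof.
move=> oO; rewrite openE => w Ow.
have /compact_near_coveringP/(_ _ (nbhs w) (fun w' x => O (w', x)) _) := S_compact.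
move=> h; have : \forall w' \near w, [set: S] `<=` (fun x => O (w', x)).
  apply: h => x _; have : nbhs (w, x) O by apply: open_nbhs_nbhs; split.
  move=> [[A B] /= [wA xB] ABO]; exists (B, A) => //= -[x' w'] [Bx Aw].
  exact: ABO.
by apply: filterS => w' /= h' x; exact: h'.
Qed.

(** The increasing open sets cover the compact fibre over [w], so one of them contains the whole
    fibre. *)
Lemma bigcup_tube (O : nat -> set (T * S)) : (forall n, open (O n)) ->
  (forall n, O n `<=` O n.+1) -> \bigcup_n O n = setT ->
  \bigcup_n [set w | forall x, O n (w, x)] = setT.
Proof.
move=> oO OS OT; have Ohomo : {homo O : j k / (j <= k)%N >-> j `<=` k}.
  exact: (homo_leq (@subset_refl _) (@subset_trans _)).
apply/seteqP; split=> // w _.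
have /compact_near_coveringP/(_ _ \oo (fun n x => O n (w, x)) _) := S_compact.
move=> h; have : \forall n \near \oo, [set: S] `<=` (fun x => O n (w, x)).
  apply: h => x _; have : setT (w, x) by [].
  rewrite -OT => -[N _ ONx].
  have : nbhs (w, x) (O N) by apply: open_nbhs_nbhs; split.
  move=> [[A B] /= [wA xB] ABO].
  exists (B, [set n | (N <= n)%N]) => /=.
    by split => //; exists N.
  move=> [x' n] [/= Bx Nn]; apply: (Ohomo _ _ Nn); apply: ABO; split => //=.
  exact: nbhs_singleton.
by move=> [n _ /(_ n (leqnn n)) hn]; exists n => // x; exact: hn.
Qed.

End tube.

Lemma open_prob_le {R : realType} {T : pseudoPMetricType R}
    (a b : probability (borel_of T) R) (q : set T -> R) :
  (forall A B, measurable (A : set (borel_of T)) ->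
    measurable (B : set (borel_of T)) -> A `<=` B -> q A <= q B) ->
  (forall A, measurable (A : set (borel_of T)) -> q (~` A) = 1 - q A) ->
  (forall O, open O -> fine (a O) <= q O) ->
  (forall O, open O -> fine (b O) <= q O) ->
  forall O, open O -> (a O <= b O)%E.
Proof.
move=> qS qC aq bq O oO.
have mO : measurable (O : set (borel_of T)) by exact: sub_sigma_algebra.
have mI k : measurable (inner O k : set (borel_of T)).
  by apply: sub_sigma_algebra; exact: inner_open.
have le_inner k : (a (inner O k) <= b O)%E.
  pose K := closure (inner O k).
  have oK : open (~` K) by apply: closed_openC; exact: closed_closure.
  have mK : measurable (K : set (borel_of T)).
    by rewrite -[K]setCK; apply: measurableC; exact: sub_sigma_algebra.
  have KO : K `<=` O.
    by apply: subset_trans (@closure_inner _ _ _ _) _; exact: inner_sub.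
  apply: (@le_trans _ _ (b K)); last by apply: le_measure; rewrite ?inE.
  rewrite -(fineK (fin_num_measure a _ (mI k))) -(fineK (fin_num_measure b _ mK)).
  rewrite lee_fin; apply: le_trans (aq _ (@inner_open _ _ _ _)) _.
  apply: (@le_trans _ _ (q K)); first by apply: qS => //; exact: subset_closure.
  have := bq _ oK; rewrite qC// probability_setC// fineB ?fin_num_measure//=.
  by rewrite lerD2l lerN2.
have := @nondecreasing_cvg_mu _ _ _ a (inner O) mI.
rewrite bigcup_inner// => /(_ mO) cvga.
have /cvg_lim <-// : a \o inner O @ \oo --> a O.
  by apply: cvga => j k jk; apply/subsetPset; exact: inner_homo.
apply: lime_le; last by apply: nearW => k; exact: le_inner.
apply/cvg_ex; exists (a O); apply: cvga => j k jk.
by apply/subsetPset; exact: inner_homo.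
Qed.

(** * Limits of equilibria *)

Section equilibrium_limits.
Context {R : realType} {W X : pmetricType R}.
Local Notation WX := (borel_of (W * X)%type).
Local Notation PWX := (probability WX R).

(** A bound of total-variation type, tested on bounded continuous functions only. It compares an
    empirical measure with those obtained when one player deviates: a single atom moves, whence the
    radius [2 / n.+1%:R] below. *)
Definition rint_close (r : R) (m1 m2 : PWX) :=
  forall (f : W * X -> R) (M : R), continuous f -> (forall z, `|f z| <= M) ->
    `|rint m1 f - rint m2 f| <= M * r.

Lemma rint_close_refl r m : 0 <= r -> rint_close r m m.
Proof.
move=> r0 f M cf fM; rewrite subrr normr0 mulr_ge0//.
exact: le_trans (fM point).
Qed.

Lemma rint_close_deviate n (w : 'I_n.+1 -> W) (x : 'I_n.+1 -> X) i y :
  rint_close (2 / n.+1%:R) (emp (profile w (deviate x i y)) : PWX)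
    (emp (profile w x)).
Proof.
move=> f M cf fM.
have mf : measurable_fun setT (f : WX -> R) by exact: continuous_borel_measurable.
rewrite /rint -![fine _]/(Rintegral _ _ _) !(emp_Rintegral _ mf fM).
rewrite -mulrBl normrM [`|_^-1|]ger0_norm// mulrA ler_pM2r ?invr_gt0 ?ltr0n//.
rewrite -sumrB (bigD1 i)//= big1 => [|j ji].
  rewrite addr0; apply: le_trans (ler_normB _ _) _.
  by have := fM (profile w (deviate x i y) i); have := fM (profile w x i); lra.
by rewrite /profile /deviate (negbTE ji) subrr.
Qed.

Variables (U : set_system nat) (UU : UltraFilter U) (U_oo : \oo `<=` U).
Variables (mn : nat -> PWX) (m : PWX).
Hypothesis mO : forall O : set (W * X), open O ->
  fine (m O) <= ultra_mass U mn O.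

(** The radius allows for one deviating player, so that for [U]-most [n] the set [E] contains [mn n]
    and every unilateral deviation from it, uniformly in the player and the new strategy. *)
Lemma weak_near (E : set PWX) : weak_open E -> E m ->
  \forall n \near U, forall m', rint_close (2 / n.+1%:R) m' (mn n) -> E m'.
Proof.
move=> /[apply] -[k [f [eps [eps0 [bcf Eeps]]]]].
have e20 : 0 < eps / 2 by rewrite divr_gt0.
suff near_i i : \forall n \near U, forall m', rint_close (2 / n.+1%:R) m' (mn n) ->
    `|rint m' (f i) - rint m (f i)| < eps.
  have : \forall n \near U, forall i m', rint_close (2 / n.+1%:R) m' (mn n) ->
      `|rint m' (f i) - rint m (f i)| < eps by exact: filter_forall.
  apply: filterS => n h m' m'n.
  by apply: Eeps => i; exact: h.
have [cf [M fM]] := bcf i.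
have M0 : 0 <= M by exact: le_trans (fM point).
have near1 : \forall n \near U, `|rint m (f i) - rint (mn n) (f i)| < eps / 2.
  have := @portmanteau_ultra _ _ U UU mn m mO _ _ cf fM.
  by move/cvgrPdist_lt; apply.
have near2 : \forall n \near U, M * (2 / n.+1%:R) < eps / 2.
  apply: U_oo; have c0 : 0 < eps / (4 * (M + 1)) by rewrite divr_gt0// mulr_gt0// ltr_wpDl.
  have := near_infty_natSinv_lt (PosNum c0); apply: filterS => n /=.
  set v := n.+1%:R^-1 => hv; have v0 : 0 <= v by rewrite invr_ge0.
  rewrite ltr_pdivlMr in hv; last by rewrite mulr_gt0// ltr_wpDl.
  nra.
near=> n; move=> m' /(_ _ _ cf fM) h.
have h1 : `|rint m (f i) - rint (mn n) (f i)| < eps / 2 by near: n.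
have h2 : M * (2 / n.+1%:R) < eps / 2 by near: n.
rewrite -(subrK (rint (mn n) (f i)) (rint m' _)) -addrA.
apply: le_lt_trans (ler_normD _ _) _.
by rewrite distrC in h1; rewrite (splitr eps) ltrD//; exact: le_lt_trans h h2.
Unshelve. all: by end_near. Qed.

Variables (F : PWX -> W -> X -> R) (C : W -> set X).
Hypothesis F_bounded : exists M : R, forall m w x, `|F m w x| <= M.
Hypothesis F_cont : F_continuous F.
Hypothesis C_lower : forall (u : nat -> W) (w : W) (x : X),
  u @ \oo --> w -> C w x ->
  exists (phi : nat -> nat) (xs : nat -> X),
    (forall k, (phi k < phi k.+1)%N) /\ (forall k, C (u (phi k)) (xs k)) /\
    xs @ \oo --> x.

(** Otherwise each ball of radius [k.+1%:R^-1] around [w] contains a counterexample; these converge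
    to [w] and contradict the sequential hypothesis. *)
Lemma C_lower_ball w y (e : R) : C w y -> 0 < e ->
  exists2 d : R, 0 < d & forall w', ball w d w' -> exists2 y', C w' y' & ball y e y'.
Proof.
move=> Cwy e0; apply: contrapT => nd.
have d0 k : 0 < k.+1%:R^-1 :> R by rewrite invr_gt0 ltr0n.
have /choice[u hu] : forall k, exists w', ball w (k.+1%:R^-1 : R) w' /\
    forall y', C w' y' -> ~ ball y e y'.
  move=> k; apply: contrapT => nk; apply: nd; exists k.+1%:R^-1 => // w' ww'.
  apply: contrapT => ny; apply: nk; exists w'; split => // y' Cy' yy'.
  by apply: ny; exists y'.
have uw : u @ \oo --> w.
  apply/cvg_ballP => r r0; have := near_infty_natSinv_lt (PosNum r0).
  by apply: filterS => k /= /ltW kr; apply: le_ball kr _ (hu k).1.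
have [phi [xs [_ [Cxs xsy]]]] := C_lower uw Cwy.
have /cvg_ballP/(_ _ e0)[k _ /(_ k (leqnn k))/=] := xsy.
exact: (hu (phi k)).2.
Qed.

Lemma F_inf_le (m' : PWX) w y : C w y -> inf [set F m' w y | y in C w] <= F m' w y.
Proof.
move=> Cwy; have [M FM] := F_bounded; apply: ge_inf; last by exists y.
by exists (- M) => _ [y' _ <-]; have := FM m' w y'; rewrite ler_norml => /andP[].
Qed.

Variables (w : nat -> W) (xs : forall n, 'I_n.+1 -> X).
Hypothesis nash : forall n, is_nash F C (fun i : 'I_n.+1 => w i) (@xs n).
Hypothesis mnE : forall n, mn n = emp (profile (fun i : 'I_n.+1 => w i) (@xs n)).

(* Near a point from which a profitable deviation exists under the limit
   measure, a player would still profit from deviating under [mn n], hence no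
   player of a Nash equilibrium sits there. *)
Lemma no_player_near w0 x0 y0 : C w0 y0 -> F m w0 y0 < F m w0 x0 ->
  exists2 d : R, 0 < d & \forall n \near U, forall k : 'I_n.+1,
    ~ (ball w0 d (w k) /\ ball x0 d (xs k)).
Proof.
(* Half the gap: perturbing both costs by less than [e] keeps the deviation strictly profitable. *)
move=> Cy0 ltF; pose e := (F m w0 x0 - F m w0 y0) / 2.
have e0 : 0 < e by rewrite divr_gt0// subr_gt0.
have [E1 [d1 [oE1 [E1m [d10 F1]]]]] := F_cont m w0 x0 e0.
have [E2 [d2 [oE2 [E2m [d20 F2]]]]] := F_cont m w0 y0 e0.
have [d3 d30 C3] := C_lower_ball Cy0 d20.
(* [d1] and [d2] control [F] near [(w0, x0)] and [(w0, y0)]; [d3] provides a feasible strategy close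
   to [y0] for each type close to [w0]. *)
pose d := Num.min d1 (Num.min d2 d3).
have dd1 : d <= d1 by rewrite ge_min lexx.
have dd2 : d <= d2 by rewrite !ge_min lexx orbT.
have dd3 : d <= d3 by rewrite !ge_min lexx !orbT.
exists d; first by rewrite !lt_min d10 d20.
apply: filterS (filterI (weak_near oE1 E1m) (weak_near oE2 E2m)).
move=> n [near1 near2] k [w0k x0k].
have [y Cy y0y] := C3 _ (le_ball dd3 w0k).
have r0 : 0 <= 2 / n.+1%:R :> R by rewrite divr_ge0.
have h1 := F1 _ _ _ (near1 _ (rint_close_refl _ r0))
  (le_ball dd1 w0k) (le_ball dd1 x0k).
pose m' : PWX := emp (profile (fun i : 'I_n.+1 => w i) (deviate (@xs n) k y)).
have m'n : rint_close (2 / n.+1%:R) m' (mn n).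
  by rewrite mnE; exact: rint_close_deviate.
have h2 := F2 _ _ _ (near2 _ m'n) (le_ball dd2 w0k) y0y.
have le_dev : F (mn n) (w k) (xs k) <= F m' (w k) y.
  rewrite mnE (nash n).2; have [M FM] := F_bounded.
  apply: ge_inf; last by exists y.
  by exists (- M) => _ [y' _ <-]; have := FM (emp (profile (fun i : 'I_n.+1 => w i)
    (deviate (@xs n) k y'))) (w k) y'; rewrite ler_norml => /andP[].
move: h1 h2; rewrite !ltr_norml => /andP[h1 _] /andP[_ h2].
by move: h1 h2 le_dev; rewrite /e; lra.
Qed.

Hypothesis C_nonempty : forall w, C w !=set0.
Hypothesis C_graph_closed : closed [set p : W * X | C p.1 p.2].
Hypotheses (W_sc : @second_countable W) (X_sc : @second_countable X).

Lemma mn_val n (A : set (W * X)) :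
  fine (mn n A) = (\sum_(i < n.+1) \1_A (w i, @xs n i)) / n.+1%:R.
Proof. by rewrite mnE emp_val. Qed.

Lemma open_null (O : set (W * X)) : open O ->
  (\forall n \near U, forall k : 'I_n.+1, ~ O (w k, xs k)) ->
  (m : set WX -> \bar R).-negligible O.
Proof.
move=> oO On; have borelO : measurable (O : set WX) by exact: sub_sigma_algebra.
apply/negligibleP => //; apply/eqP; rewrite -fine_eq0 ?fin_num_measure//.
rewrite eq_le fine_ge0// andbT; apply: le_trans (mO oO) _.
apply: ultra_mass_le => //; apply: filterS On => n hn.
by rewrite mn_val big1 ?mul0r// => i _; rewrite indicE memNset.
Qed.

Lemma limit_ae_optimal : {ae m, forall z : WX,
  C z.1 z.2 /\ F m z.1 z.2 = inf [set F m z.1 y | y in C z.1]}.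
Proof.
have [bW [obW basisW]] := second_countable_seq W_sc.
have [bX [obX basisX]] := second_countable_seq X_sc.
pose box i j := bW i `*` bX j.
have obox i j : open (box i j).
  rewrite /box (_ : _ `*` _ = (bW i `*` setT) `&` (snd @^-1` bX j)).
    apply: openI; first exact: open_setXT.
    by apply: open_comp => // z _; exact: cvg_snd.
  by apply/seteqP; split=> z; rewrite /setX/=; tauto.
(* This set is empty unless the box is negligible, so the union over all [i] and [j] is negligible
   and no selection of boxes is needed. *)
pose null i j := [set z | box i j z /\ (m : set WX -> \bar R).-negligible (box i j)].
have null_neg i j : (m : set WX -> \bar R).-negligible (null i j).
  have [h|h] := pselect ((m : set WX -> \bar R).-negligible (box i j)).
    by apply: negligibleS h => z [].
  by apply: (@negligibleS _ _ _ _ set0) => [z []|]; last exact: negligible_set0.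
have [A [mA A0 subA]] : (m : set WX -> \bar R).-negligible
    (~` [set p : W * X | C p.1 p.2] `|` \bigcup_i \bigcup_j null i j).
  apply: negligibleU; last first.
    by apply: negligible_bigcup => i; apply: negligible_bigcup => j.
  (* The complement of the graph is open and contains no player of any equilibrium. *)
  apply: open_null; first exact: closed_openC.
  by apply: nearW => n k /=; apply; exact: (nash n).1.
exists A; split => //; apply: subset_trans subA => -[w0 x0] /= notopt.
apply: contrapT => /not_orP[/contrapT/= Cx0 nnull].
apply: notopt; split => //; apply/eqP; rewrite eq_le F_inf_le// andbT.
apply: lb_le_inf; first by have [y Cy] := C_nonempty w0; exists (F m w0 y), y.
move=> _ [y0 Cy0 <-]; rewrite leNgt; apply/negP => ltF.
have [d d0 nod] := no_player_near Cy0 ltF.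
have bd (T : pmetricType R) (z : T) : (ball z d)^° z.
  exact: (nbhs_singleton (nbhs_interior (nbhsx_ballx z _ d0))).
have [i wi id] := basisW w0 _ (@open_interior _ _) (bd W w0).
have [j xj jd] := basisX x0 _ (@open_interior _ _) (bd X x0).
apply: nnull; exists i => //; exists j => //; split=> //.
apply: open_null => //; apply: filterS nod => n hn k [/= /id wk /jd xk].
by apply: (hn k); split; exact: interior_subset.
Qed.

End equilibrium_limits.

(** * Almost sure convergence of the equilibrium sets *)

Theorem theorem2p6 (R : realType) (W X : pmetricType R)
  (* W complete and separable, X compact *)
  (W_complete : forall F : set_system W, ProperFilter F -> cauchy F -> cvg F)
  (W_separable : exists D : set W, countable D /\ dense D)
  (X_compact : compact [set: X])
  (* the constraint correspondence C *)
  (C : W -> set X)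
  (C_nonempty : forall w, C w !=set0)
  (C_closed : forall w, closed (C w))
  (C_graph_closed : closed [set p : (W * X)%type | C p.1 p.2])
  (C_lower : forall (u : nat -> W) (w : W) (x : X), u @ \oo --> w -> C w x ->
     exists (phi : nat -> nat) (xs : nat -> X),
       (forall k, (phi k < phi k.+1)%N) /\ (forall k, C (u (phi k)) (xs k)) /\
       xs @ \oo --> x)
  (* the cost function F, bounded and continuous *)
  (F : probability (borel_of (W * X)%type) R -> W -> X -> R)
  (F_bounded : exists M : R, forall m w x, `|F m w x| <= M)
  (F_cont : F_continuous F)
  (* existence of Nash equilibria for every n and every type vector *)
  (nash_exists : forall (n : nat) (w : 'I_n.+1 -> W), exists x, is_nash F C w x)
  (* i.i.d. types W_0, W_1, ... with law lam0 on a probability space *)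
  (lam0 : probability (borel_of W) R)
  (dO : measure_display) (Omega : measurableType dO) (P : probability Omega R)
  (Wr : nat -> Omega -> borel_of W)
  (Wr_meas : forall i, measurable_fun [set: Omega] (Wr i))
  (Wr_iid : iid P Wr lam0) :
  (* almost surely, N_n -> M(lam0) in the upper Vietoris topology *)
  {ae P, forall omega,
     forall E : set (probability (borel_of (W * X)%type) R),
       weak_open E -> Mset F C lam0 `<=` E ->
       exists N : nat, forall n : nat, (N <= n)%N ->
         Nhat F C (fun i : 'I_n.+1 => Wr i omega) `<=` E}.
Proof.
have [D [cD dD]] := W_separable.
have W_sc := separable_second_countable cD dD.
have X_sc : @second_countable X := compact_second_countable X_compact.
have ae_lower := empirical_open_lower W_sc Wr_meas Wr_iid.
apply: filterS ae_lower => omega lower E oE ME; apply: contrapT => /forallNP notE.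
pose w i : W := Wr i omega.
pose B := [set n | ~ (Nhat F C (fun i : 'I_n.+1 => w i) `<=` E)].
(* An equilibrium is chosen for every [n], with empirical measure outside [E] when [n] is in [B] and
   arbitrary otherwise. *)
have ex_nash n : exists x : 'I_n.+1 -> X, is_nash F C (fun i : 'I_n.+1 => w i) x /\
    (B n -> ~ E (emp (profile (fun i : 'I_n.+1 => w i) x))).
  have [Bn|nBn] := pselect (B n); last first.
    by have [x nx] := nash_exists n (fun i : 'I_n.+1 => w i); exists x.
  have [m [[x [nx mx]] nEm]] : exists m,
      Nhat F C (fun i : 'I_n.+1 => w i) m /\ ~ E m.
    apply: contrapT => nm; apply: Bn => m Nm; apply: contrapT => nEm.
    by apply: nm; exists m.
  exists x; split => // _ Ex; apply: nEm.
  (* [Nhat] identifies [m] with the empirical measure only as a set function. Weak openness depends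
     on integrals alone, so it transfers membership in [E]. *)
  have [k [f [eps [eps0 [_ Eeps]]]]] := oE _ Ex.
  by apply: Eeps => i; rewrite /rint mx subrr normr0.
pose xs n := sval (cid (ex_nash n)).
have nash n : is_nash F C (fun i : 'I_n.+1 => w i) (xs n) := (svalP (cid (ex_nash n))).1.
have notE_mn n : B n -> ~ E (emp (profile (fun i : 'I_n.+1 => w i) (xs n))) :=
  (svalP (cid (ex_nash n))).2.
pose mn n : probability (borel_of (W * X)%type) R :=
  emp (profile (fun i : 'I_n.+1 => w i) (xs n)).
(* [B] is unbounded, so an ultrafilter can refine [\oo] and contain [B]. *)
have properB : ProperFilter (within B \oo).
  apply: Build_ProperFilter_ex => A [N _ NA].
  have /existsNP[n /not_implyP[Nn Bn]] := notE N.
  by exists n; exact: (NA n Nn Bn).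
have [U [UU subU]] := ultraFilterLemma properB.
have U_oo : \oo `<=` U.
  by move=> A ooA; apply: subU; apply: filterS ooA => n An _.
have UB : U B by apply: subU; exact: withinT.
pose p (A : set (W * X)) := ultra_mass U mn (A : set (borel_of (W * X)%type)).
have borelWX (O : set (W * X)) :
  open O -> measurable (O : set (borel_of (W * X)%type)).
  exact: sub_sigma_algebra.
have lam0_le (O : set W) : open O -> fine (lam0 O) <= p (O `*` setT).
  move=> oO; apply/ler_addgt0Pr => e e0; rewrite -lerBlDr.
  apply: (ultra_mass_ge UU); first by apply: borelWX; exact: open_setXT.
  apply: U_oo; have [N hN] := lower O e oO e0; exists N => // n /hN.
  move=> /le_trans; apply; rewrite /mn emp_val/= ler_pM2r ?invr_gt0 ?ltr0n//.
  by apply: ler_sum => i _; rewrite !indicE ler_nat; case: (boolP (_ \in O)) => //;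
    rewrite inE => Ow; rewrite mem_set.
have p_tight (O : nat -> set (W * X)) : (forall n, open (O n)) ->
    (forall n, O n `<=` O n.+1) -> \bigcup_n O n = setT ->
    forall e : R, 0 < e -> exists n, 1 - e <= p (O n).
  move=> oO OS OT e e0; pose G n := [set w | forall x, O n (w, x)].
  have oG n : open (G n) by exact: open_tube.
  have mG n : measurable (G n : set (borel_of W)) by exact: sub_sigma_algebra.
  have GT : \bigcup_n G n = setT by exact: bigcup_tube.
  have GS : {homo G : j k / (j <= k)%N >-> (j <= k)%O}.
    apply: (homo_leq (@lexx _ _) le_trans) => k.
    by apply/subsetPset => v Gv x; exact/OS/Gv.
  have /fine_cvg/cvgr_gt/(_ (1 - e)) : lam0 \o G @ \oo --> 1%:E.
    rewrite -[1%:E](probability_setT lam0) -GT.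
    exact: (nondecreasing_cvg_mu mG (bigcupT_measurable _ mG) GS).
  rewrite gtrBl e0 => /(_ isT) [n _ /(_ n (leqnn n))/= hn].
  exists n; apply: le_trans (ltW hn) _; apply: le_trans (lam0_le _ (oG n)) _.
  apply: (ultra_massS UU); [by apply: borelWX; exact: open_setXT|exact: borelWX|].
  by move=> [v x] [Gv _]; exact: Gv.
have [m mp] : exists m : probability (borel_of (W * X)%type) R,
    forall O : set (W * X), open O -> (m O <= (p O)%:E)%E.
  apply: open_content_extension => //.
  - exact: ultra_mass0.
  - exact: ultra_massT.
  - by move=> A oA; apply: (ultra_mass_ge0 UU); exact: borelWX.
  - by move=> A A' oA oA'; rewrite /p => AA'; apply: (ultra_massS UU) => //; exact: borelWX.
  - by move=> A A' oA oA'; apply: (ultra_massU_le UU); exact: borelWX.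
  - by move=> A A' oA oA' AA'; rewrite /p (ultra_massU UU)//; exact: borelWX.
have mO (O : set (W * X)) : open O -> fine (m O) <= ultra_mass U mn O.
  move=> oO; rewrite -lee_fin fineK; first exact: mp.
  by rewrite fin_num_measure//; exact: borelWX.
have mfst : measurable_fun setT (fst : borel_of (W * X)%type -> borel_of W).
  by apply: continuous_borel_fun => z; exact: cvg_fst.
pose pi : {mfun borel_of (W * X)%type >-> borel_of W} := mfun_Sub (mem_set mfst).
pose m1 : probability (borel_of W) R := distribution m pi.
have m1E (A : set (borel_of W)) : m1 A = m (A `*` setT).
  by congr (m _); apply/seteqP; split=> [z|z []].
have mXT (A : set W) : measurable (A : set (borel_of W)) ->
    measurable (A `*` setT : set (borel_of (W * X)%type)).
  move=> mA; rewrite (_ : _ `*` _ = setT `&` fst @^-1` A); first exact: (mfst measurableT _ mA).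
  by apply/seteqP; split=> [z []|z []].
have qS (A A' : set W) : measurable (A : set (borel_of W)) ->
    measurable (A' : set (borel_of W)) -> A `<=` A' ->
    p (A `*` setT) <= p (A' `*` setT).
  move=> mA mA' AA'; apply: (ultra_massS UU); [exact: mXT..|].
  by move=> z [/AA' ? _].
have qC (A : set W) : measurable (A : set (borel_of W)) ->
    p (~` A `*` setT) = 1 - p (A `*` setT).
  move=> mA; rewrite -(ultra_massC UU mn (mXT _ mA)); congr p.
  by apply/seteqP; split=> z; rewrite /setX/= => h; tauto.
have m1p (A : set W) : open A -> fine (m1 A) <= p (A `*` setT).
  by move=> oA; rewrite m1E; apply: mO; exact: open_setXT.
have m1lam0 (A : set W) : open A -> m1 A = lam0 A.
  move=> oA; apply/eqP; rewrite eq_le; apply/andP; split.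
    exact: (open_prob_le qS qC m1p lam0_le).
  exact: (open_prob_le qS qC lam0_le m1p).
have marginal (A : set (borel_of W)) : measurable A -> m (A `*` setT) = lam0 A.
  move=> mA; rewrite -m1E.
  apply: (@measure_unique _ R (borel_of W) (@open W) (fun=> setT) _ _ _ _ m1 lam0) => //.
  - by move=> A1 A2 oA1 oA2; exact: openI.
  - by move=> _; exact: openT.
  - by rewrite bigcup_const.
  - by move=> _; rewrite -ge0_fin_numE ?fin_num_measure.
have Mm : Mset F C lam0 m.
  split; first exact: marginal.
  exact: (limit_ae_optimal UU U_oo mO F_bounded F_cont C_lower nash
    (fun=> erefl) C_nonempty C_graph_closed W_sc X_sc).
have near_E := weak_near UU U_oo mO oE (ME _ Mm).
have [n [Bn hn]] := filter_ex (filterI UB near_E).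
apply: (notE_mn n Bn); apply: hn; apply: rint_close_refl.
by rewrite divr_ge0.
Qed.
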